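(* Let $p\geq 17$ be a prime. There exists a covering system of the integers whose moduli are all odd and greater than $1$, in which exactly $p-5$ congruences have modulus $p$ and the congruences with moduli different from $p$ have pairwise distinct moduli. Further, this covering system has no congruence with modulus $p^2$.
   Context: A covering system is a finite collection of congruences $r_i\pmod{m_i}$ such that every integer satisfies at least one of them. *)

(* Defs.v *)
From mathcomp Require Import all_boot all_order all_algebra.

Set Implicit Arguments.
Unset Strict Implicit.
Unset Printing Implicit Defensive.

(* The pair (r, m) stands for the congruence r (mod m). *)
Definition congruence : Type := (int * nat)%type.

Definition residue (c : congruence) : int := c.1.
Definition modulus (c : congruence) : nat := c.2.

Definition satisfies (n : int) (c : congruence) : bool :=
  (n == residue c %[mod (modulus c)%:Z])%Z.

(* Two pairs denote the same congruence when the moduli agree and the residues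
   agree modulo it, e.g. (1, 3) and (4, 3). *)
Definition same_congruence (c d : congruence) : bool :=
  (modulus c == modulus d) &&
  (residue c == residue d %[mod (modulus c)%:Z])%Z.

(* A finite collection is a sequence of pairwise different congruences, so that
   counting its entries counts congruences. *)
Definition covering_system (s : seq congruence) : Prop :=
  [/\ forall c, c \in s -> 0 < modulus c,
      pairwise (fun c d => ~~ same_congruence c d) s
    & forall n : int, exists2 c, c \in s & satisfies n c].

(* Main.v *)
(*
Write n = q^v u with q not dividing u; the leading digit of n at q is u mod q,
and a congruence modulo q^(v+1) can prescribe the pair (v, leading digit).
Fix the primes q_0 = p, 3, 5, 7, 11, 13, q6 <= 19, q7 <= 23 and a table of digit
patterns, each prescribing nonzero digits at some of these primes, no two at the
same set of primes.  A pattern with prime set S yields one congruence for every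
choice of positive exponents on S, and all these moduli differ by unique
factorization.  So one finite table, covering all combinations of leading digits
with the digit at p restricted to {1, ..., 5}, treats every n whose valuations
are bounded; the other p - 5 classes modulo p are used up by the modulus p
itself.  If instead a large power of q divides n, the moduli r q^j with
j = 1, ..., r and one further prime r cover n, as j runs over all classes mod r.
*)
Require Import Defs.
From mathcomp Require Import all_boot all_order all_algebra.

Set Implicit Arguments.
Unset Strict Implicit.
Unset Printing Implicit Defensive.

(** * Chinese remainder theorem for finite families *)

Lemma coprime_prod_seq (I : eqType) (s : seq I) (m : I -> nat) (a : nat) :
  {in s, forall i, coprime a (m i)} -> coprime a (\prod_(i <- s) m i).
Proof.
elim: s => [|i s IHs] cop_s; first by rewrite big_nil coprimen1.
rewrite big_cons coprimeMr cop_s ?mem_head //=.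
by apply: IHs => j sj; rewrite cop_s // inE sj orbT.
Qed.

Section ChineseRemainder.

Variables (I : finType) (m : I -> nat).
Hypothesis coprime_m : forall i j, i != j -> coprime (m i) (m j).

Let coprime_rest i s : i \notin s -> coprime (m i) (\prod_(j <- s) m j).
Proof.
move=> s'i; apply: coprime_prod_seq => j sj; apply: coprime_m.
by apply: contraNneq s'i => ->.
Qed.

Lemma chinese_family_exists (r : I -> nat) :
  exists x, forall i, x = r i %[mod m i].
Proof.
suffices [x xP]: exists x, {in enum I, forall i, x = r i %[mod m i]}.
  by exists x => i; apply: xP; rewrite mem_enum.
elim: (enum I) (enum_uniq I) => [|i s IHs] /=; first by exists 0.
case/andP=> s'i /IHs[y yP].
exists (chinese (m i) (\prod_(j <- s) m j) (r i) y) => j.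
rewrite inE => /orP[/eqP-> | sj]; first exact/chinese_modl/coprime_rest.
have m_dvd: m j %| \prod_(k <- s) m k by rewrite (big_rem j) //= dvdn_mulr.
by rewrite -(modn_dvdm _ m_dvd) chinese_modr ?coprime_rest // modn_dvdm // yP.
Qed.

Lemma eqn_mod_prod (a b : nat) :
  (forall i, a = b %[mod m i]) -> a = b %[mod \prod_i m i].
Proof.
move=> ab; rewrite -big_enum /=.
elim: (enum I) (enum_uniq I) => [|i s IHs] /=; first by rewrite big_nil !modn1.
case/andP=> s'i /IHs abs; apply/eqP.
by rewrite big_cons chinese_remainder ?coprime_rest // ab abs !eqxx.
Qed.

End ChineseRemainder.

(** * Unique factorization for products of prime powers *)

Section PrimePowerProducts.

Variables (I : finType) (P : I -> nat).
Hypotheses (P_prime : forall i, prime (P i)) (P_inj : injective P).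

Lemma coprime_prime_powers (e : I -> nat) i j :
  i != j -> coprime (P i ^ e i) (P j ^ e j).
Proof.
move=> neq_ij; apply/coprimeXl/coprimeXr; rewrite prime_coprime //.
by rewrite dvdn_prime2 // (inj_eq P_inj).
Qed.

Lemma prime_powers_gt0 (e : I -> nat) : 0 < \prod_i P i ^ e i.
Proof. by rewrite prodn_gt0 // => i; rewrite expn_gt0 prime_gt0. Qed.

Lemma logn_prime_powers (e : I -> nat) i :
  logn (P i) (\prod_j P j ^ e j) = e i.
Proof.
rewrite (bigD1 i) //= mulnC logn_Gauss ?pfactorK //.
rewrite -big_filter; apply: coprime_prod_seq => j.
rewrite mem_filter andbC => /andP[_ neq_ji].
by rewrite coprimeXr // prime_coprime // dvdn_prime2 // (inj_eq P_inj) eq_sym.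
Qed.

(** The valuation at [P i] is positive on the left and 0 on the right. With [P j = p] and k = 0, 1,
    2 this keeps the moduli away from 1, p and p^2. *)
Lemma prime_powers_neq_exp (e : I -> nat) i j k :
  i != j -> 0 < e i -> \prod_t P t ^ e t != P j ^ k.
Proof.
move=> neq_ij; apply: contraTneq => eq_e; rewrite -(logn_prime_powers e i) eq_e.
rewrite lognX logn_prime // (inj_eq P_inj).
by rewrite (negPf neq_ij) muln0.
Qed.

End PrimePowerProducts.

(** * Leading digits at a prime *)

Definition leading_digit (q n : nat) : nat := n %/ q ^ logn q n %% q.

Lemma leading_digit_bounds (q n : nat) :
  prime q -> 0 < n -> 0 < leading_digit q n < q.
Proof.
move=> q_pr n_gt0; rewrite /leading_digit ltn_mod (prime_gt0 q_pr) andbT lt0n.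
have [u cop_qu {1}->] := pfactor_coprime q_pr n_gt0.
by rewrite mulnK ?expn_gt0 ?prime_gt0 // -/(dvdn q u) -prime_coprime.
Qed.

Lemma mod_leading_digit (q n : nat) :
  n = leading_digit q n * q ^ logn q n %[mod q ^ (logn q n).+1].
Proof.
by rewrite /leading_digit muln_modl -expnS modn_mod divnK ?pfactor_dvdnn.
Qed.


(** * Reduction from integers to natural numbers *)

Lemma satisfies_nat (n x m : nat) :
  satisfies (Posz n) (Posz x, m) = (n == x %[mod m]).
Proof. by rewrite /satisfies /= !modz_nat eqz_nat. Qed.

(** Satisfaction is periodic modulo the product N of all moduli, so n may be replaced by its
    remainder modulo N, which is nonnegative. *)
Lemma covers_from_nat (s : seq congruence) :
    {in s, forall c, 0 < modulus c} ->
    (forall n : nat, exists2 c, c \in s & satisfies (Posz n) c) ->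
  forall n : int, exists2 c, c \in s & satisfies n c.
Proof.
move=> s_gt0 s_nat n; set N := \prod_(c <- s) modulus c.
have N_gt0: 0 < N by rewrite /N big_seq prodn_cond_gt0.
have [c sc n'c] := s_nat `|(n %% N)%Z|%N; exists c => //.
have N_c: (modulus c %| N)%N by rewrite /N (big_rem c) //= dvdn_mulr.
move: n'c; rewrite /satisfies gez0_abs ?modz_ge0 -?lt0n //; move/eqP<-.
rewrite eqz_mod_dvd {1}(divz_eq n N) GRing.addrK.
exact: dvdz_mull.
Qed.

(** * Digit patterns and the finite check *)

Definition matches (row ds : seq nat) : Prop :=
  forall t, nth 0 row t = 0 \/ nth 0 row t = nth 0 ds t.

(** Branches on the digit in the first column, keeping the rows compatible with it. A row with only
    zeros left matches whatever digits follow, so its branch closes at once; this prunes the search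
    over a box of 11404800 points. *)
Fixpoint covers_box (bounds : seq nat) (rows : seq (seq nat)) : bool :=
  if has (all (pred1 0)) rows then true else
  if bounds is b :: bounds' then
    all (fun d => covers_box bounds'
           [seq behead row | row <- rows & head 0 row \in [:: 0; d]]) (iota 1 b)
  else false.

Lemma covers_boxP (bounds ds : seq nat) (rows : seq (seq nat)) :
    covers_box bounds rows -> size ds = size bounds ->
    (forall t, t < size ds -> 0 < nth 0 ds t <= nth 0 bounds t) ->
  exists2 row, row \in rows & matches row ds.
Proof.
have zero_row ds' rows' : has (all (pred1 0)) rows' ->
    exists2 row, row \in rows' & matches row ds'.
  case/hasP=> row row_in /all_nthP row0; exists row => // t; left.
  by case: (ltnP t (size row)) => [/(row0 0)/eqP | /(nth_default 0)].
elim: bounds ds rows => [|b bounds IHb] ds rows /=; case: ifP => //.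
- by move=> /zero_row.
- by move=> /zero_row.
move=> _; case: ds => // d ds /allP cov [sz_ds] bds.
have d_in: d \in iota 1 b by rewrite mem_iota add1n ltnS; exact: (bds 0).
have [|_ /mapP[row + ->] row_ds] := IHb ds _ (cov _ d_in) sz_ds.
  by move=> t lt_t; apply: (bds t.+1).
rewrite mem_filter !inE => /andP[head_row row_in]; exists row => // -[|t] /=.
  by rewrite nth0; case/orP: head_row => /eqP; [left | right].
by rewrite -nth_behead; apply: row_ds.
Qed.

(* Columns: p, 3, 5, 7, 11, 13, q6, q7. *)
Definition digit_bounds : seq nat := [:: 5; 2; 4; 6; 10; 12; 18; 22].

(* Columns as in [digit_bounds]; 0 leaves the digit free.  Found by computer
   search. *)
Definition table : seq (seq nat) :=
  [:: [:: 0; 1; 0; 0; 0; 0; 0; 0]; [:: 0; 0; 2; 0; 0; 0; 0; 0]; [:: 0; 0; 0; 4; 0; 0; 0; 0];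
      [:: 0; 0; 0; 0; 10; 0; 0; 0]; [:: 0; 0; 0; 0; 0; 6; 0; 0]; [:: 0; 0; 0; 0; 0; 0; 13; 0];
      [:: 0; 0; 0; 0; 0; 0; 0; 8]; [:: 5; 2; 0; 0; 0; 0; 0; 0]; [:: 2; 0; 3; 0; 0; 0; 0; 0];
      [:: 4; 0; 0; 2; 0; 0; 0; 0]; [:: 3; 0; 0; 0; 4; 0; 0; 0]; [:: 3; 0; 0; 0; 0; 8; 0; 0];
      [:: 3; 0; 0; 0; 0; 0; 3; 0]; [:: 3; 0; 0; 0; 0; 0; 0; 18]; [:: 0; 2; 4; 0; 0; 0; 0; 0];
      [:: 0; 2; 0; 6; 0; 0; 0; 0]; [:: 0; 2; 0; 0; 7; 0; 0; 0]; [:: 0; 2; 0; 0; 0; 12; 0; 0];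
      [:: 0; 2; 0; 0; 0; 0; 6; 0]; [:: 0; 2; 0; 0; 0; 0; 0; 5]; [:: 0; 0; 1; 5; 0; 0; 0; 0];
      [:: 0; 0; 1; 0; 5; 0; 0; 0]; [:: 0; 0; 1; 0; 0; 4; 0; 0]; [:: 0; 0; 3; 0; 0; 0; 15; 0];
      [:: 0; 0; 3; 0; 0; 0; 0; 15]; [:: 0; 0; 0; 2; 6; 0; 0; 0]; [:: 0; 0; 0; 3; 0; 5; 0; 0];
      [:: 0; 0; 0; 3; 0; 0; 12; 0]; [:: 0; 0; 0; 3; 0; 0; 0; 1]; [:: 0; 0; 0; 0; 1; 2; 0; 0];
      [:: 0; 0; 0; 0; 3; 0; 11; 0]; [:: 0; 0; 0; 0; 8; 0; 0; 2]; [:: 0; 0; 0; 0; 0; 2; 18; 0];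
      [:: 0; 0; 0; 0; 0; 2; 0; 12]; [:: 1; 2; 3; 0; 0; 0; 0; 0]; [:: 4; 2; 0; 3; 0; 0; 0; 0];
      [:: 3; 2; 0; 0; 9; 0; 0; 0]; [:: 3; 2; 0; 0; 0; 10; 0; 0]; [:: 3; 2; 0; 0; 0; 0; 9; 0];
      [:: 3; 2; 0; 0; 0; 0; 0; 9]; [:: 4; 0; 3; 5; 0; 0; 0; 0]; [:: 3; 0; 3; 0; 5; 0; 0; 0];
      [:: 3; 0; 3; 0; 0; 3; 0; 0]; [:: 3; 0; 3; 0; 0; 0; 8; 0]; [:: 3; 0; 3; 0; 0; 0; 0; 17];
      [:: 2; 0; 0; 2; 4; 0; 0; 0]; [:: 1; 0; 0; 3; 0; 10; 0; 0]; [:: 3; 0; 0; 5; 0; 0; 1; 0];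
      [:: 3; 0; 0; 5; 0; 0; 0; 22]; [:: 3; 0; 0; 0; 1; 5; 0; 0]; [:: 3; 0; 0; 0; 3; 0; 2; 0];
      [:: 3; 0; 0; 0; 8; 0; 0; 10]; [:: 3; 0; 0; 0; 0; 4; 17; 0]; [:: 3; 0; 0; 0; 0; 1; 0; 12];
      [:: 0; 2; 1; 1; 0; 0; 0; 0]; [:: 0; 2; 1; 0; 8; 0; 0; 0]; [:: 0; 2; 1; 0; 0; 3; 0; 0];
      [:: 0; 2; 3; 0; 0; 0; 14; 0]; [:: 0; 2; 3; 0; 0; 0; 0; 13]; [:: 0; 2; 0; 2; 3; 0; 0; 0];
      [:: 0; 2; 0; 3; 0; 11; 0; 0]; [:: 0; 2; 0; 3; 0; 0; 1; 0]; [:: 0; 2; 0; 3; 0; 0; 0; 22];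
      [:: 0; 2; 0; 0; 1; 7; 0; 0]; [:: 0; 2; 0; 0; 6; 0; 11; 0]; [:: 0; 2; 0; 0; 8; 0; 0; 6];
      [:: 0; 2; 0; 0; 0; 2; 17; 0]; [:: 0; 2; 0; 0; 0; 2; 0; 3]; [:: 0; 0; 1; 2; 2; 0; 0; 0];
      [:: 0; 0; 1; 3; 0; 9; 0; 0]; [:: 0; 0; 3; 5; 0; 0; 12; 0]; [:: 0; 0; 3; 5; 0; 0; 0; 19];
      [:: 0; 0; 1; 0; 3; 2; 0; 0]; [:: 0; 0; 3; 0; 3; 0; 16; 0]; [:: 0; 0; 3; 0; 8; 0; 0; 14];
      [:: 0; 0; 3; 0; 0; 5; 17; 0]; [:: 0; 0; 3; 0; 0; 1; 0; 10]; [:: 0; 0; 0; 3; 6; 7; 0; 0];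
      [:: 0; 0; 0; 5; 6; 0; 18; 0]; [:: 0; 0; 0; 2; 8; 0; 0; 19]; [:: 0; 0; 0; 3; 0; 2; 11; 0];
      [:: 0; 0; 0; 3; 0; 1; 0; 20]; [:: 0; 0; 0; 0; 9; 2; 7; 0]; [:: 0; 0; 0; 0; 8; 7; 0; 12];
      [:: 4; 2; 3; 1; 0; 0; 0; 0]; [:: 3; 2; 3; 0; 2; 0; 0; 0]; [:: 3; 2; 3; 0; 0; 9; 0; 0];
      [:: 3; 2; 3; 0; 0; 0; 5; 0]; [:: 3; 2; 3; 0; 0; 0; 0; 16]; [:: 2; 2; 0; 2; 9; 0; 0; 0];
      [:: 2; 2; 0; 3; 0; 10; 0; 0]; [:: 3; 2; 0; 1; 0; 0; 12; 0]; [:: 3; 2; 0; 3; 0; 0; 0; 19];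
      [:: 3; 2; 0; 0; 1; 1; 0; 0]; [:: 3; 2; 0; 0; 6; 0; 7; 0]; [:: 3; 2; 0; 0; 8; 0; 0; 20];
      [:: 3; 2; 0; 0; 0; 1; 17; 0]; [:: 3; 2; 0; 0; 0; 4; 0; 12]; [:: 1; 0; 1; 2; 4; 0; 0; 0];
      [:: 1; 0; 1; 3; 0; 8; 0; 0]; [:: 3; 0; 3; 5; 0; 0; 4; 0]; [:: 3; 0; 3; 3; 0; 0; 0; 11];
      [:: 3; 0; 3; 0; 1; 11; 0; 0]; [:: 3; 0; 3; 0; 3; 0; 7; 0]; [:: 3; 0; 3; 0; 8; 0; 0; 21];
      [:: 3; 0; 3; 0; 0; 11; 17; 0]; [:: 3; 0; 3; 0; 0; 1; 0; 3]; [:: 1; 0; 0; 3; 9; 7; 0; 0];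
      [:: 3; 0; 0; 5; 6; 0; 10; 0]; [:: 3; 0; 0; 1; 8; 0; 0; 19]; [:: 3; 0; 0; 3; 0; 4; 4; 0];
      [:: 1; 0; 0; 0; 4; 2; 2; 0]; [:: 3; 0; 0; 0; 8; 11; 0; 3]; [:: 3; 0; 0; 0; 0; 1; 4; 2];
      [:: 0; 2; 1; 2; 1; 0; 0; 0]; [:: 0; 2; 1; 3; 0; 1; 0; 0]; [:: 0; 2; 3; 1; 0; 0; 1; 0];
      [:: 0; 2; 3; 1; 0; 0; 0; 11]; [:: 0; 2; 1; 0; 3; 7; 0; 0]; [:: 0; 2; 3; 0; 3; 0; 10; 0];
      [:: 0; 2; 3; 0; 8; 0; 0; 4]; [:: 0; 2; 1; 0; 0; 2; 5; 0]; [:: 0; 2; 3; 0; 0; 7; 0; 3];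
      [:: 0; 2; 0; 3; 6; 2; 0; 0]; [:: 0; 2; 0; 1; 6; 0; 2; 0]; [:: 0; 2; 0; 1; 8; 0; 0; 1];
      [:: 0; 2; 0; 3; 0; 2; 4; 0]; [:: 0; 2; 0; 3; 0; 1; 0; 4]; [:: 0; 2; 0; 0; 9; 2; 2; 0];
      [:: 0; 2; 0; 0; 8; 5; 0; 3]; [:: 0; 0; 1; 3; 2; 2; 0; 0]; [:: 0; 0; 3; 1; 6; 0; 10; 0];
      [:: 0; 0; 3; 2; 8; 0; 0; 22]; [:: 0; 0; 1; 3; 0; 2; 9; 0]; [:: 0; 0; 3; 3; 0; 1; 0; 6];
      [:: 0; 0; 1; 0; 4; 2; 10; 0]; [:: 0; 0; 3; 0; 6; 4; 0; 10]; [:: 0; 0; 0; 3; 4; 2; 7; 0];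
      [:: 0; 0; 0; 3; 6; 4; 0; 7]; [:: 1; 2; 1; 2; 9; 0; 0; 0]; [:: 2; 2; 1; 3; 0; 8; 0; 0];
      [:: 3; 2; 3; 1; 0; 0; 4; 0]; [:: 3; 2; 3; 1; 0; 0; 0; 22]; [:: 3; 2; 3; 0; 1; 4; 0; 0];
      [:: 3; 2; 3; 0; 3; 0; 18; 0]; [:: 3; 2; 3; 0; 8; 0; 0; 7]; [:: 3; 2; 3; 0; 0; 7; 17; 0];
      [:: 3; 2; 3; 0; 0; 4; 0; 3]; [:: 2; 2; 0; 3; 9; 7; 0; 0]; [:: 3; 2; 0; 1; 6; 0; 16; 0];
      [:: 3; 2; 0; 5; 8; 0; 0; 1]; [:: 1; 2; 0; 3; 0; 2; 3; 0]; [:: 3; 2; 0; 3; 0; 1; 0; 14];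
      [:: 2; 2; 0; 0; 4; 2; 2; 0]; [:: 3; 2; 0; 0; 8; 11; 0; 12]; [:: 1; 0; 1; 3; 4; 7; 0; 0];
      [:: 3; 0; 3; 5; 6; 0; 16; 0]; [:: 3; 0; 3; 2; 8; 0; 0; 11]; [:: 2; 0; 1; 3; 0; 2; 3; 0];
      [:: 3; 0; 3; 3; 0; 1; 0; 7]; [:: 3; 0; 3; 0; 6; 4; 0; 2]; [:: 3; 0; 0; 3; 3; 7; 4; 0];
      [:: 3; 0; 0; 3; 6; 4; 0; 4]; [:: 0; 2; 1; 3; 2; 7; 0; 0]; [:: 0; 2; 3; 1; 6; 0; 18; 0];
      [:: 0; 2; 3; 5; 8; 0; 0; 11]; [:: 0; 2; 1; 3; 0; 2; 15; 0]; [:: 0; 2; 3; 3; 0; 1; 0; 21];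
      [:: 0; 2; 1; 0; 9; 2; 14; 0]; [:: 0; 2; 3; 0; 8; 5; 0; 12]; [:: 0; 2; 0; 3; 9; 2; 8; 0];
      [:: 0; 2; 0; 3; 6; 4; 0; 14]; [:: 0; 0; 1; 3; 4; 2; 8; 0]; [:: 2; 2; 1; 3; 4; 7; 0; 0];
      [:: 3; 2; 3; 5; 6; 0; 2; 0]; [:: 3; 2; 3; 2; 8; 0; 0; 1]; [:: 1; 2; 1; 3; 0; 2; 16; 0];
      [:: 2; 2; 1; 0; 9; 2; 16; 0]; [:: 3; 2; 3; 0; 6; 4; 0; 21]; [:: 2; 2; 0; 3; 9; 2; 10; 0];
      [:: 3; 2; 0; 3; 6; 1; 0; 2]; [:: 2; 0; 1; 3; 4; 2; 16; 0]; [:: 3; 0; 3; 3; 6; 4; 0; 6];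
      [:: 0; 2; 1; 3; 4; 2; 14; 0]; [:: 1; 2; 1; 3; 9; 2; 10; 0]; [:: 3; 2; 3; 3; 6; 4; 0; 20]].

Definition support (row : seq nat) : seq bool := [seq 0 < c | c <- row].

(** Recovers a row from its set of primes. For a set absent from the table the result is [[::]],
    whose entries all read as 0. *)
Definition lookup (b : seq bool) : seq nat :=
  nth [::] table (index b (map support table)).

Lemma table_covers : covers_box digit_bounds table.
Proof. by vm_compute. Qed.

(** The second check gives each pattern a prime other than p, so that its moduli are not powers of
    p. The third says that different rows have different supports. *)
Lemma table_rows :
  all (fun row => [&& size row == 8, has id (behead (support row))
                    & lookup (support row) == row]) table.
Proof. by vm_compute. Qed.

(** * Congruences indexed by exponent vectors *)

Definition exponents (K : nat) : finType := {ffun 'I_9 -> 'I_K.+1}.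

(* Coordinate 8 is the auxiliary prime r: the exponent vectors with a nonzero
   exponent there serve the moduli r q^j, for which the sum below is j, so that
   the residues are j mod r and 0 mod q^j.  Other such vectors, and those whose
   support is not in the table, give superfluous congruences. *)
Definition residue_at (P : 'I_9 -> nat) (K : nat) (e : exponents K)
    (t : 'I_9) : nat :=
  if 0 < e ord_max then
    if t == ord_max then \sum_(u | u != ord_max) e u else 0
  else nth 0 (lookup [seq 0 < e (inord u) | u <- iota 0 8]) t * P t ^ (e t).-1.

Section Covering.

Variables (P : 'I_9 -> nat) (n : nat).
Hypotheses (P_prime : forall t, prime (P t)) (n_gt0 : 0 < n).

Let K := P ord_max.

Lemma cover_large_power (s : 'I_9) :
    s != ord_max -> K <= logn (P s) n ->
  exists2 e : exponents K, 0 < e ord_max &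
    forall t, n = residue_at P e t %[mod P t ^ e t].
Proof.
move=> s_neq le_K.
have K_gt0: 0 < K by exact/prime_gt0/P_prime.
(* The class of 0 modulo [K] is represented by j = [K]. *)
have [j [j_gt0 le_jK nj]]: exists j, [/\ 0 < j, j <= K & n = j %[mod K]].
  have [nK | nK] := posnP (n %% K).
    by exists K; split=> //; rewrite nK modnn.
  by exists (n %% K); split; rewrite ?modn_mod // ltnW // ltn_mod.
pose e : exponents K :=
  [ffun t => inord (if t == ord_max then 1 else if t == s then j else 0)].
have eE t : e t = (if t == ord_max then 1 else if t == s then j else 0) :> nat.
  by rewrite ffunE inordK //; do 2?[case: ifP] => *; rewrite ltnS.
exists e => [|t]; first by rewrite eE eqxx.
(* The modulus is r q^j with q = [P s]. At r the exponents other than that of r sum to j, congruent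
   to n; at q, j <= [K] <= [logn q n] gives n = 0 modulo q^j; elsewhere the modulus is 1. *)
rewrite /residue_at !eE eqxx /=; case: eqP => [-> | /eqP t_neq].
  rewrite expn1 (bigD1 s) //= big1 => [|u /andP[/negPf u_neq /negPf u_s]].
    by rewrite eE (negPf s_neq) eqxx addn0.
  by rewrite eE u_neq u_s.
case: eqP => [->|_]; last by rewrite !modn1.
apply/eqP; rewrite mod0n; apply: (dvdn_trans (dvdn_exp2l _ le_jK)).
by rewrite pfactor_dvdn.
Qed.

(** The leading digits of n form a point of the box, hence match some row. At each prime q of that
    row the exponent v + 1, with v the valuation of n, makes the prescribed residue digit * q^v
    agree with n. *)
Lemma cover_small_powers :
    (forall t : 'I_9, t != ord_max -> logn (P t) n < K) ->
    (forall t : 'I_9, t != ord_max ->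
       leading_digit (P t) n <= nth 0 digit_bounds t) ->
  exists2 e : exponents K, exists2 t, t != ord0 & 0 < e t &
    forall t, n = residue_at P e t %[mod P t ^ e t].
Proof.
move=> small bnd.
have ltP (t : nat) : t < 8 -> (inord t : 'I_9) = t :> nat /\ inord t != ord_max :> 'I_9.
  move=> lt_t8; have tE: (inord t : 'I_9) = t :> nat by rewrite inordK // ltnW.
  by rewrite -val_eqE /= tE neq_ltn lt_t8.
pose ds := mkseq (fun t => leading_digit (P (inord t)) n) 8.
have [||row row_in row_ds] := @covers_boxP _ ds _ table_covers.
- by rewrite size_mkseq.
- move=> t; rewrite size_mkseq => lt_t8; rewrite nth_mkseq //.
  have [tE t_neq] := ltP t lt_t8.
  have /andP[-> _] := leading_digit_bounds (P_prime (inord t)) n_gt0.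
  by rewrite -{2}tE bnd.
have /and3P[/eqP sz_row row_nz /eqP row_lookup] := allP table_rows _ row_in.
pose e : exponents K :=
  [ffun t : 'I_9 => inord (if nth 0 row t == 0 then 0 else (logn (P t) n).+1)].
have row_max : nth 0 row (@ord_max 8) = 0 by rewrite nth_default ?sz_row.
(* The strict bound v < [K] is what lets v + 1 fit into ['I_K.+1]. *)
have eE t : e t = (if nth 0 row t == 0 then 0 else (logn (P t) n).+1) :> nat.
  rewrite ffunE inordK //; case: eqP => // row_t; rewrite ltnS small //.
  by apply: contra_not_neq row_t => ->.
(* The support of [e] is that of [row], so [lookup] returns this very row. *)
have supp_e : [seq 0 < e (inord u) | u <- iota 0 8] = support row.
  apply: (@eq_from_nth _ false); rewrite !size_map ?sz_row // size_iota => u lt_u8.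
  rewrite (nth_map 0) ?size_iota // (nth_map 0) ?sz_row // nth_iota // add0n eE.
  by rewrite (ltP u lt_u8).1; case: (nth 0 row u).
exists e => [|t].
  case/(has_nthP false): row_nz => u.
  rewrite size_behead size_map sz_row nth_behead => lt_u7 /=.
  have [uE _] := ltP u.+1 lt_u7.
  rewrite (nth_map 0) ?sz_row // => row_u; exists (inord u.+1).
    by rewrite -val_eqE /= uE.
  by rewrite eE uE; case: (nth 0 row u.+1) row_u.
rewrite /residue_at supp_e row_lookup !eE row_max eqxx /=.
case: eqP => [_ | row_t]; first by rewrite !modn1.
have t_neq: t != ord_max by apply: contra_not_neq row_t => ->.
have lt_t8: t < 8 by rewrite ltn_neqAle -ltnS ltn_ord andbT; exact: t_neq.
case: (row_ds t) => // ->; rewrite nth_mkseq // inord_val /=.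
exact: mod_leading_digit.
Qed.

End Covering.

(** * Choice of the primes and assembly of the system *)

Lemma auxiliary_primes (p : nat) :
    prime p -> 17 <= p ->
  exists q6 q7 r : nat,
    [/\ all prime [:: q6; q7; r], all odd [:: q6; q7; r],
        uniq [:: p; 3; 5; 7; 11; 13; q6; q7; r] & q6 <= 19 /\ q7 <= 23].
Proof.
move=> p_prime p_ge17.
have small q : q < 17 -> (p == q) = false.
  by move=> lt_q; rewrite gtn_eqF // (leq_trans lt_q).
(* Take the three smallest primes from 17 on that differ from p; the digits at q6 and q7 then stay
   within the bounds 18 and 22. *)
have [-> | p17] := eqVneq p 17; first by exists 19, 23, 29.
have [-> | p19] := eqVneq p 19; first by exists 17, 23, 29.
have [-> | p23] := eqVneq p 23; first by exists 17, 19, 29.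
exists 17, 19, 23; split=> //=.
by rewrite !inE (small 3) ?(small 5) ?(small 7) ?(small 11) ?(small 13) ?(negPf p17) ?(negPf p19) ?(negPf p23).
Qed.

Theorem theorem2p4 (p : nat) (p_prime : prime p) (p_ge17 : 17 <= p) :
  exists s : seq congruence,
    [/\ covering_system s,
        forall c, c \in s -> odd (modulus c) /\ 1 < modulus c,
        count (fun c => modulus c == p) s = p - 5,
        uniq [seq modulus c | c <- s & modulus c != p]
      & forall c, c \in s -> modulus c <> p ^ 2].
Proof.
have [q6 [q7 [r [aux_pr aux_odd bs_uniq [q6_le q7_le]]]]] :=
  auxiliary_primes p_prime p_ge17.
pose bs := [:: p; 3; 5; 7; 11; 13; q6; q7; r].
pose P (t : 'I_9) := nth 0 bs t; pose K := P ord_max.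
have P_inj : injective P.
  move=> t u /eqP; rewrite nth_uniq // => /eqP; exact: val_inj.
have p_gt0 : 0 < p by apply: prime_gt0.
have p_odd : odd p by case: (even_prime p_prime) p_ge17 => // ->.
have bs_pr : all prime bs by rewrite /= p_prime.
have bs_odd : all odd bs by rewrite /= p_odd.
have P_prime t : prime (P t) by apply: (all_nthP 0 bs_pr).
have P_odd t : odd (P t) by apply: (all_nthP 0 bs_odd).
pose M (e : exponents K) := \prod_t P t ^ e t.
(* Some prime other than p must occur, so that [M e] is not a power of p. *)
pose G := [pred e : exponents K | [exists t, (t != ord0) && (0 < e t)]].
have M_gt0 e : 0 < M e by apply: prime_powers_gt0.
have M_inj : injective M.
  move=> e e' eq_M; apply/ffunP => t; apply: val_inj => /=.
  by rewrite -(logn_prime_powers P_prime P_inj (fun u => e u : nat)) -/(M e) eq_M logn_prime_powers.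
have M_neq e k : e \in G -> M e != p ^ k.
  case/existsP=> t /andP[t_neq e_t].
  exact: (@prime_powers_neq_exp _ P P_prime P_inj (fun u => e u) t ord0).
have M_odd e : odd (M e).
  by rewrite /M; elim/big_ind: _ => // [a b|t _]; rewrite ?oddM ?oddX ?P_odd ?orbT // => ->.
have place (e : exponents K) : exists y, forall t, y = residue_at P e t %[mod P t ^ e t].
  by apply: chinese_family_exists; apply: coprime_prime_powers.
have [x xP] := fin_all_exists place.
(* The 1 + (p - 6) = p - 5 classes modulo p other than 1, ..., 5. *)
pose js := 0 :: iota 6 (p - 6).
pose A : seq congruence := [seq (Posz j, p) | j <- js].
pose B : seq congruence := [seq (Posz (x e), M e) | e <- enum G].
have js_lt : all (fun j => j < p) js.
  rewrite /= p_gt0; apply/allP => j; rewrite mem_iota => /andP[_].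
  by rewrite subnKC // (leq_trans _ p_ge17).
have B_G c : c \in B -> exists2 e, e \in G & c = (Posz (x e), M e).
  by case/mapP=> e; rewrite mem_enum; exists e.
have A_p c : c \in A -> modulus c = p by case/mapP=> j _ ->.
have B_p c : c \in B -> modulus c != p.
  by case/B_G=> e Ge -> /=; have := M_neq e 1 Ge; rewrite expn1.
exists (A ++ B); split.
- have AB_gt0 : {in A ++ B, forall c, 0 < modulus c}.
    by move=> c; rewrite mem_cat => /orP[/A_p-> // | /B_G[e _ ->]]; apply: M_gt0.
  split=> [|| n]; first exact: AB_gt0.
    (* Moduli separate [A] from [B] and the members of [B] from each other; within [A] the residues,
       all below p, differ. *)
    rewrite pairwise_cat !pairwise_map; apply/and3P; split.
    - apply/allrelP => c d /A_p c_p /B_p; rewrite -c_p eq_sym.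
      by rewrite /same_congruence; case: eqP.
    - apply: (@sub_in_pairwise _ [pred j | j < p] [rel i j | i != j]) js_lt _.
        move=> i j; rewrite !inE /= => lt_i lt_j.
        by rewrite /same_congruence /= eqxx !modz_nat eqz_nat !modn_small.
      by rewrite -uniq_pairwise /= mem_iota iota_uniq.
    - have := enum_uniq G; rewrite uniq_pairwise; apply: sub_pairwise => e e' /=.
      by rewrite /same_congruence /= (inj_eq M_inj) => /negPf->.
  apply: covers_from_nat n => // n.
  have [n_js | n_js] := boolP (n %% p \in js).
    exists (Posz (n %% p), p); last by rewrite satisfies_nat modn_mod.
    by rewrite mem_cat map_f.
  (* In the remaining classes p does not divide n, so the leading digit at p is n mod p itself, at
     most 5. *)
  have /andP[np_gt0 np_le5] : 0 < n %% p <= 5.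
    move: n_js; rewrite inE mem_iota subnKC; last by rewrite (leq_trans _ p_ge17).
    by rewrite (ltn_mod n p) p_gt0 andbT negb_or -lt0n -ltnNge ltnS.
  have n_gt0 : 0 < n by case: (n) np_gt0; rewrite ?mod0n.
  have logn_p : logn p n = 0.
    by rewrite logn_coprime // prime_coprime // /dvdn -lt0n.
  suffices [e Ge ne] : exists2 e, e \in G &
      forall t, n = residue_at P e t %[mod P t ^ e t].
    exists (Posz (x e), M e); first by rewrite mem_cat map_f ?orbT ?mem_enum.
    rewrite satisfies_nat; apply/eqP/eqn_mod_prod => [|t].
      exact: coprime_prime_powers.
    by rewrite ne xP.
  (* Either some prime other than r has valuation at least r in n, or all these valuations fit into
     [exponents K]. *)
  have [t /andP[t_neq le_K] | small] :=
    pickP [pred t | (t != ord_max) && (K <= logn (P t) n)].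
    have [e e_max ne] := cover_large_power P_prime n_gt0 t_neq le_K.
    by exists e => //; apply/existsP; exists ord_max.
  have [t t_neq | t t_neq | e [t t_neq e_t] ne] :=
    @cover_small_powers P n P_prime n_gt0.
  - by have := small t; rewrite /= t_neq leqNgt => /negbFE.
  - have [-> | t_neq0] := eqVneq t ord0.
      by rewrite /leading_digit /P /= logn_p divn1.
    (* At a prime q other than p the digit is at most q - 1, which never exceeds the entry of
       [digit_bounds]. *)
    have /andP[_ lt_P] := leading_digit_bounds (P_prime t) n_gt0.
    rewrite -ltnS (leq_trans lt_P) //.
    by case: t t_neq t_neq0 {lt_P} => -[|[|[|[|[|[|[|[|[|t]]]]]]]]] //=.
  - by exists e => //; apply/existsP; exists t; rewrite t_neq.
- move=> c; rewrite mem_cat => /orP[/A_p-> | /B_G[e Ge ->]].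
    by rewrite p_odd prime_gt1.
  rewrite /= M_odd ltn_neqAle M_gt0 andbT eq_sym.
  by have := M_neq e 0 Ge; rewrite expn0.
- rewrite count_cat.
  have /eqP-> : count (fun c => modulus c == p) A == size A.
    by rewrite -all_count; apply/allP=> c /A_p->.
  have /eqP-> : count (fun c => modulus c == p) B == 0.
    by rewrite -leqn0 leqNgt -has_count; apply/hasPn => c /B_p.
  by rewrite size_map /= size_iota addn0 -subSn // (leq_trans _ p_ge17).
- rewrite filter_cat.
  have -> : [seq c <- A | modulus c != p] = [::].
    by apply/eqP; rewrite -[_ == _]negbK -has_filter; apply/hasPn=> c /A_p->; rewrite eqxx.
  rewrite (all_filterP _); last by apply/allP.
  by rewrite -map_comp map_inj_uniq ?enum_uniq //; apply: M_inj.
- move=> c; rewrite mem_cat => /orP[/A_p-> | /B_G[e Ge ->]].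
    by apply/eqP; rewrite neq_ltn ltn_Pmull ?prime_gt1.
  by apply/eqP; rewrite M_neq.
Qed.
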